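(* Let $R$ be a subring of $\mathbb{R}$, let $G$ be a connected $R$-graph with genus $g$ and canonical divisor $K$, and let $D$ be an $R$-divisor on $G$. Then $$h^0(D) - h^0(K-D) = \deg(D) + 1 - g.$$
   Context: Let $R$ be a subring of $\mathbb{R}$ (containing $1$). An $R$-graph $G$ is a finite connected graph without loops or multiple edges in which each edge is assigned a weight that is a positive element of $R$. Its vertices are $v_1,\dots,v_n$; $p_{ij}=p_{ji}$ denotes the weight of the edge joining $v_i$ and $v_j$, and $p_{ij}=p_{ji}=0$ if there is no such edge. The degree of a vertex is $\deg(v_j)=\sum_{i\ne j}p_{ij}$. The genus of $G$ is $g=\sum_{i<j}p_{ij}-n+1$ (it may be negative or non-integral). An $R$-divisor on $G$ is a formal sum $D=\sum_{i=1}^n d_i\cdot v_i$ with each $d_i\in R$; these form the free $R$-module $\mathrm{Div}(G)$ of rank $n$. The degree of a divisor is $\deg(D)=\sum_i d_i$. For a constant $c$, $D\ge c$ (resp. $D>c$) means $d_i\ge c$ (resp. $d_i>c$) for every $i$. The canonical divisor is $K=\sum_i(\deg(v_i)-2)\cdot v_i$. Let $H_j=\deg(v_j)\cdot v_j-\sum_{i\ne j}p_{ij}\cdot v_i$ and $\mathrm{PDiv}(G)=\{\sum_{i=1}^n c_iH_i : c_i\in\mathbb{Z}\}$. Write $D\sim D'$ if $D-D'\in\mathrm{PDiv}(G)$. The linear system of $D$ is $|D|=\{D'\in\mathrm{Div}(G) : D\sim D',\ D'>-1\}$ (equivalently, $\lceil D'\rceil\ge 0$, where the ceiling is taken coordinatewise).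 Define $$h^0(D)=\min\{\deg(E) : E \text{ is an } R\text{-divisor},\ E\ge 0,\ |D-E|=\emptyset\}.$$ *)

(* Defs.v *)
From HB Require Import structures.
From mathcomp Require Import all_boot all_order all_algebra.
From mathcomp Require Import classical_sets reals.

Set Implicit Arguments.
Unset Strict Implicit.
Unset Printing Implicit Defensive.

Import Order.TTheory GRing.Theory Num.Theory.

Local Open Scope classical_set_scope.
Local Open Scope ring_scope.

(* [S] is the coefficient subring of the reals [R].  The vertices are 'I_n, and
   i, j are joined by an edge exactly when [weight i j] is nonzero. *)
Record wgraph (R : realType) (S : subringClosed R) (n : nat) := WGraph {
  weight : 'M[R]_n;
  weight_over : weight \is a mxOver S;
  weight_ge0 : forall i j, 0 <= weight i j;
  weight_sym : forall i j, weight i j = weight j i;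
  weight_loopless : forall i, weight i i = 0;
  wgraph_nonempty : (0 < n)%N;
  wgraph_connected : forall i j, connect (fun x y => weight x y != 0) i j
}.

Section WGraphDivisors.
Variables (R : realType) (S : subringClosed R) (n : nat) (G : wgraph S n).
Implicit Types D E : 'rV[R]_n.

(* A row vector stands for the formal sum of its entries times the vertices;
   it is an S-divisor when it belongs to [mxOver S]. *)
Definition vtx (i : 'I_n) : 'rV[R]_n := delta_mx 0 i.

Definition degv (j : 'I_n) : R := \sum_(i | i != j) weight G i j.

Definition genus : R :=
  \sum_(i < n) \sum_(j < n | (i < j)%N) weight G i j - n%:R + 1.

Definition degd D : R := \sum_(i < n) D 0 i.

Definition canonical_div : 'rV[R]_n := \sum_(i < n) (degv i - 2) *: vtx i.

Definition Hdiv (j : 'I_n) : 'rV[R]_n :=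
  degv j *: vtx j - \sum_(i | i != j) weight G i j *: vtx i.

Definition pdiv_set : set 'rV[R]_n :=
  [set D | exists c : 'I_n -> int, D = \sum_(i < n) Hdiv i *~ c i].

Definition lin_equiv D D' : Prop := pdiv_set (D - D').

Definition linear_system D : set 'rV[R]_n :=
  [set D' | [/\ D' \is a mxOver S, lin_equiv D D' & forall i, -1 < D' 0 i]].

Definition h0_degrees D : set R :=
  [set degd E | E in [set E | [/\ E \is a mxOver S, forall i, 0 <= E 0 i
                                & linear_system (D - E) = set0]]].

End WGraphDivisors.

Definition is_min (R : realType) (A : set R) (m : R) : Prop :=
  A m /\ lbound A m.

(* The minimum of [h0_degrees G D]; the value 0 is a junk default, used only
   if no minimum exists. *)
Definition h0 (R : realType) (S : subringClosed R) (n : nat) (G : wgraph S n)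
    (D : 'rV[R]_n) : R :=
  xget 0 [set m | is_min (h0_degrees G D) m].

(* Main.v *)
Require Import Defs.
From HB Require Import structures.
From mathcomp Require Import all_boot all_order all_algebra.
From mathcomp Require Import classical_sets reals.
From mathcomp Require Import perm.
From mathcomp Require Import ring lra.

Set Implicit Arguments.
Unset Strict Implicit.
Unset Printing Implicit Defensive.

Import Order.TTheory GRing.Theory Num.Theory.

Local Open Scope ring_scope.

(** For an ordering s of the vertices, let [order_div s] have coefficient
    -1 + (total weight of the edges from v to earlier vertices) at v: the
    divisor of the acyclic orientation that points every edge to its later
    end.  Three facts carry the theorem.

    - No divisor D' > -1 is equivalent to [order_div s] ([order_div_special]),
      and conversely every D with empty linear system is equivalent to some
      D' <= [order_div s] ([special_le_order_div], a version of Dhar's burning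
      algorithm).  Hence D - E has an empty linear system exactly when
      E >= D - N for some N equivalent to an [order_div s], and the cheapest
      effective E for a given N is the positive part of D - N.  So h0 D is the
      minimum of deg^+ (D - N) over these N; in the code N is
      [order_div s - lap c], and deg^+ (D - N) is [excess D s c].

    - Reversing the ordering exchanges earlier and later vertices, so
      K - [order_div s] = [order_div (rev_order s)]: the set of the N is stable
      under N |-> K - N.  All the N have degree g - 1.

    - Writing N' = K - N, we get (K - D) - N = -(D - N'), and
      deg^+ (- A) = deg^+ A - deg A.  So passing from D to K - D shifts all the
      values that are minimised by the constant deg D - (g - 1), and therefore
      shifts the minimum by it ([excess_dual]).

    The coefficients are real, so the minimum over the infinite set of the
    N, and the termination of the burning algorithm, need an argument.  Both
    come from [lap_bound]: on a connected graph, only finitely many integer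
    potentials, up to an additive constant, have a Laplacian that is bounded
    above by a given real number. *)

Section RiemannRoch.
Variables (R : realType) (S : subringClosed R) (n : nat) (G : wgraph S n).
Implicit Types (D E : 'rV[R]_n) (c : 'I_n -> int) (s : {perm 'I_n}).
Local Notation w := (weight G).

(** * The weighted Laplacian *)

(** The principal divisor of the integer potential [c], see [sum_HdivE]. *)
Definition lap c : 'rV[R]_n := \row_i \sum_j w i j * (c i - c j)%:~R.

Lemma degvE i : degv G i = \sum_j w i j.
Proof.
rewrite (bigD1 i) //= weight_loopless add0r.
by apply: eq_bigr => j _; rewrite weight_sym.
Qed.

Lemma HdivE i j : (Hdiv G j) 0 i = degv G i * (i == j)%:R - w i j.
Proof.
rewrite !mxE eqxx summxE /=; congr (_ - _).
  by case: eqVneq => [->|]; rewrite ?mulr0.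
under eq_bigr => k _ do rewrite !mxE eqxx /=.
have [->|nij] := eqVneq i j.
  rewrite weight_loopless big1 // => k /negPf; rewrite eq_sym => ->.
  by rewrite mulr0.
rewrite (bigD1 i) //= eqxx mulr1 big1 ?addr0 // => k /andP[_ /negPf].
by rewrite eq_sym => ->; rewrite mulr0.
Qed.

Lemma sum_HdivE c : \sum_(i < n) Hdiv G i *~ c i = lap c.
Proof.
apply/rowP => i; rewrite summxE mxE.
under eq_bigr => j _ do rewrite -scaler_int mxE HdivE mulrBr.
under [RHS]eq_bigr => j _ do rewrite intrB mulrBr.
rewrite !sumrB; congr (_ - _); last by apply: eq_bigr => j _; rewrite mulrC.
rewrite (bigD1 i) //= eqxx mulr1 big1 ?addr0 => [|j /negPf]; last first.
  by rewrite eq_sym => ->; rewrite !mulr0.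
by rewrite degvE mulrC mulr_suml.
Qed.

Lemma lapD c c' : lap (fun i => c i + c' i) = lap c + lap c'.
Proof.
apply/rowP => i; rewrite !mxE -big_split /=; apply: eq_bigr => j _.
by rewrite -mulrDr -intrD; congr (_ * _%:~R); ring.
Qed.

Lemma lapN c : lap (fun i => - c i) = - lap c.
Proof.
apply/rowP => i; rewrite !mxE -sumrN; apply: eq_bigr => j _.
by rewrite -mulrN -intrN; congr (_ * _%:~R); ring.
Qed.

Lemma lap0 : lap (fun=> 0) = 0.
Proof. by apply/rowP => i; rewrite !mxE big1 // => j _; rewrite subr0 mulr0. Qed.

Lemma lap_shift c a : lap (fun i => c i - a) = lap c.
Proof.
apply/rowP => i; rewrite !mxE; apply: eq_bigr => j _.
by congr (_ * _%:~R); ring.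
Qed.

Lemma lap_over c : lap c \is a mxOver S.
Proof.
apply/mxOverP => i j; rewrite mxE rpred_sum // => k _.
by rewrite rpredM ?rpred_int // (mxOverP (weight_over G)).
Qed.

Lemma degdD D E : degd (D + E) = degd D + degd E.
Proof. by rewrite /degd -big_split; apply: eq_bigr => i _; rewrite mxE. Qed.

Lemma degdN D : degd (- D) = - degd D.
Proof. by rewrite /degd -sumrN; apply: eq_bigr => i _; rewrite mxE. Qed.

Lemma degd_lap c : degd (lap c) = 0.
Proof.
rewrite /degd; under eq_bigr => i _ do rewrite mxE.
set T := \sum_i _; suff : T = - T by move=> ?; lra.
rewrite {1}/T exchange_big /= -sumrN; apply: eq_bigr => i _.
rewrite -sumrN; apply: eq_bigr => j _.
by rewrite (weight_sym G) -mulrN -intrN opprB.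
Qed.

(** The members of [linear_system G D] are automatically S-divisors, because
    principal divisors are. *)
Lemma linear_system_eq0 D : D \is a mxOver S ->
  linear_system G D = set0 <-> forall c, exists i, (D - lap c) 0 i <= -1.
Proof.
move=> D_div; split=> [D0 c|D0].
  apply/existsP; apply: contra_eqT D0 => /existsPn D_gt; apply/eqP => D0.
  suff : linear_system G D (D - lap c) by rewrite D0.
  split=> [||i]; last by rewrite ltNge D_gt.
  - by rewrite rpredB // lap_over.
  - by exists c; rewrite sum_HdivE subKr.
apply/seteqP; split=> // D' [_ [c]].
rewrite sum_HdivE => DD' D'_gt; have [i] := D0 c.
by rewrite -DD' subKr leNgt D'_gt.
Qed.

(** * Divisors of vertex orderings *)

(** The value [s i] is the position of the vertex i. *)
Definition order_div s : 'rV[R]_n := \row_i (-1 + \sum_(j | (s j < s i)%N) w i j).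

Definition rev_order s : {perm 'I_n} := (s * perm rev_ord_inj)%g.

Lemma rev_orderE s i j : (rev_order s j < rev_order s i)%N = (s i < s j)%N.
Proof.
rewrite !permM !permE /=; have := ltn_ord (s i); have := ltn_ord (s j).
by move: (nat_of_ord _) (nat_of_ord _) => a b lta ltb; rewrite ltn_sub2lE.
Qed.

Lemma sum_weight_split s i :
  \sum_j w i j = \sum_(j | (s j < s i)%N) w i j + \sum_(j | (s i < s j)%N) w i j.
Proof.
rewrite [X in _ = X + _]big_mkcond [X in _ = _ + X]big_mkcond -big_split /=.
apply: eq_bigr => j _; case: ltngtP; rewrite ?addr0 ?add0r // => eq_s.
by rewrite (perm_inj (val_inj eq_s)) weight_loopless.
Qed.

(** Each edge at a vertex goes either to an earlier or to a later vertex, so at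
    every vertex the two coefficients add up to its degree minus 2. *)
Lemma canonical_sub_order_div s :
  canonical_div G - order_div s = order_div (rev_order s).
Proof.
apply/rowP => i; rewrite !mxE summxE (bigD1 i) //= big1 => [|j /negPf]; last first.
  by rewrite eq_sym !mxE => ->; rewrite mulr0.
rewrite !mxE !eqxx /= degvE (sum_weight_split s).
under [in RHS]eq_bigl => j do rewrite rev_orderE.
lra.
Qed.

(** Each edge is counted once, at its later end. *)
Lemma degd_order_div s : degd (order_div s) = genus G - 1.
Proof.
pose T s := \sum_i \sum_(j | (s j < s i)%N) w i j.
(* T does not depend on the ordering, which allows a comparison with the natural
   (here reversed) ordering of the vertices that defines the genus. *)
have half r : 2 * T r = \sum_i \sum_j w i j.
  under [RHS]eq_bigr => i _ do rewrite (sum_weight_split r).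
  rewrite big_split /= -/(T r) mulrDl !mul1r; congr (_ + _).
  rewrite (exchange_big_dep predT) //=; apply: eq_bigr => i _.
  by apply: eq_bigr => j _; rewrite weight_sym.
have -> : degd (order_div s) = T s - n%:R.
  rewrite /degd; under eq_bigr => i _ do rewrite mxE.
  by rewrite big_split /= sumr_const card_ord addrC mulNrn.
have -> : genus G = T (rev_order 1%g) - n%:R + 1.
  rewrite /genus /T; congr (_ - _ + _); apply: eq_bigr => i _.
  by apply: eq_bigl => j; rewrite rev_orderE !perm1.
have := half s; rewrite -(half (rev_order 1%g)); lra.
Qed.

(** Among the vertices where the potential is maximal, take the first one in
    the ordering.  All earlier vertices have a potential smaller by at least 1,
    so subtracting the Laplacian removes at least the weight that those
    neighbours contribute to [order_div s]. *)
Lemma order_div_special s c : exists i, (order_div s - lap c) 0 i <= -1.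
Proof.
pose i0 := Ordinal (wgraph_nonempty G).
have [k _ k_max] := arg_maxP c (isT : xpredT i0).
have [i /eqP cik i_first] :=
  arg_minP (fun i => s i : nat) (eqxx (c k) : (fun i => c i == c k) k).
exists i; rewrite !mxE big_mkcond -addrA gerDl -sumrB sumr_le0 // => j _.
have w_ge0 := weight_ge0 G i j.
have le_c : c j <= c i by rewrite cik; exact: k_max.
case: ifP => [lt_s|_]; last first.
  by rewrite sub0r oppr_le0 mulr_ge0 // ler0z subr_ge0.
rewrite -[X in X - _]mulr1 -mulrBr mulr_ge0_le0 // subr_le0.
rewrite ler1z -gtz0_ge1 subr_gt0 lt_neqAle le_c andbT.
apply: contraTneq lt_s => cji; rewrite -leqNgt; apply: i_first.
by rewrite cji cik.
Qed.

Lemma degd_canonical : degd (canonical_div G) = 2 * (genus G - 1).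
Proof.
rewrite -(subrK (order_div 1%g) (canonical_div G)) canonical_sub_order_div.
by rewrite degdD !degd_order_div; ring.
Qed.

(** * Potentials with bounded Laplacian *)

(** Induction along a path that starts at the maximum of the potential: if the
    drop from the maximum to y is at most K, the bound on the Laplacian at y
    bounds the sum of the terms w y k * (c i0 - c k).  These terms are
    nonnegative, so each of them is bounded, in particular at the next vertex of
    the path. *)
Lemma lap_bound_from_max (B : R) i0 j : connect (fun x y => w x y != 0) i0 j ->
  exists K : R, forall c, (forall i, lap c 0 i <= B) -> (forall i, c i <= c i0) ->
    (c i0 - c j)%:~R <= K.
Proof.
case/connectP => p + ->; elim/last_ind: p => [_|p z IHp].
  by exists 0 => c _ _; rewrite subrr.
rewrite rcons_path last_rcons => /andP[/IHp[K K_bound]].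
set y := last i0 p => wyz; have wyz_gt0 : 0 < w y z.
  by rewrite lt_neqAle eq_sym wyz weight_ge0.
exists ((B + (\sum_k w y k) * K) / w y z) => c lapB c_max.
rewrite ler_pdivlMr // mulrC.
apply: le_trans (_ : \sum_k w y k * (c i0 - c k)%:~R <= _).
  rewrite (bigD1 z) //= lerDl sumr_ge0 // => k _.
  by rewrite mulr_ge0 ?weight_ge0 // ler0z subr_ge0.
have -> : \sum_k w y k * (c i0 - c k)%:~R
    = lap c 0 y + (\sum_k w y k) * (c i0 - c y)%:~R.
  rewrite mxE mulr_suml -big_split /=; apply: eq_bigr => k _.
  by rewrite -mulrDr -intrD; congr (_ * _%:~R); ring.
rewrite lerD // ler_wpM2l ?sumr_ge0 // ?K_bound // => k _.
exact: weight_ge0.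
Qed.

(** The bound does not depend on the potential, because there are only finitely
    many pairs of vertices. *)
Lemma lap_bound (B : R) : exists K : nat, forall c, (forall i, lap c 0 i <= B) ->
  forall i j, c i - c j <= K%:Z.
Proof.
have /fin_all_exists[K K_bound] (p : 'I_n * 'I_n) : exists K : R, forall c,
    (forall i, lap c 0 i <= B) -> (forall i, c i <= c p.1) ->
    (c p.1 - c p.2)%:~R <= K.
  exact: lap_bound_from_max (wgraph_connected G _ _).
exists (Num.bound (\sum_p `|K p|)) => c lapB i j.
have [k _ k_max] := arg_maxP c (isT : xpredT i).
rewrite -(ler_int R); apply: le_trans (_ : (c k - c j)%:~R <= _).
  by rewrite ler_int lerD2r; exact: k_max.
apply: le_trans (K_bound (k, j) c lapB _) _ => [l|]; first exact: k_max.
apply: le_trans (ler_norm _) _; apply: le_trans (_ : \sum_p `|K p| <= _).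
  by rewrite (bigD1 (k, j)) //= lerDl sumr_ge0.
by rewrite ltW // archi_boundP // sumr_ge0.
Qed.

(** * Burning *)

(** A fire that starts at the vertices with coefficient at most -1 and spreads
    to a vertex as soon as the weight of its edges to burnt vertices reaches its
    coefficient plus 1 burns the whole graph. *)
Definition burnt D := forall U : {set 'I_n}, (exists i, i \in U) ->
  exists2 i, i \in U & D 0 i <= -1 + \sum_(j | j \notin U) w i j.

(** Order the vertices by the time at which they burn. *)
Lemma burning_order D : burnt D -> exists s, forall i, D 0 i <= order_div s 0 i.
Proof.
move=> D_burnt.
have [l [l_size l_uniq l_burn]] : exists l : seq 'I_n, [/\ size l = n, uniq l &
    forall i, i \in l ->
      D 0 i <= -1 + \sum_(j | (index j l < index i l)%N) w i j].
  (* A burnt set of size k < n grows by a vertex of its complement. *)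
  suff : forall k, (k <= n)%N -> exists l : seq 'I_n, [/\ size l = k, uniq l &
    forall i, i \in l ->
      D 0 i <= -1 + \sum_(j | (index j l < index i l)%N) w i j] by exact.
  elim=> [_|k IHk lt_kn]; first by exists [::].
  have [l [l_size l_uniq l_burn]] := IHk (ltnW lt_kn).
  have [|i] := D_burnt (finset (fun i => i \notin l)).
    apply/existsP; apply: contraTT lt_kn => /existsPn l_all.
    rewrite -leqNgt -l_size -{1}(card_ord n); apply: leq_trans (card_size l).
    apply/subset_leq_card/fintype.subsetP => i _.
    by have := l_all i; rewrite inE negbK.
  rewrite inE => iNl D_i; exists (rcons l i).
  rewrite size_rcons l_size rcons_uniq iNl; split=> // j.
  rewrite mem_rcons inE => /predU1P[->|jl].
    apply: le_trans D_i _; rewrite lerD2l le_eqVlt; apply/orP; left.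
    apply/eqP/eq_bigl => h; rewrite inE negbK -!cats1 !index_cat (negPf iNl) /=.
    rewrite eqxx addn0; case: ifP => hl; first by rewrite index_mem.
    by rewrite ltnNge leq_addr.
  apply: le_trans (l_burn j jl) _; rewrite lerD2l le_eqVlt; apply/orP; left.
  apply/eqP/eq_bigl => h; rewrite -!cats1 !index_cat jl /=.
  case: ifP => // /negbT /memNindex ->; rewrite !ltnNge index_size.
  by rewrite (leq_trans (index_size _ _)) ?leq_addr.
have mem_l i : i \in l.
  have l_card : #|l| = #|'I_n| by rewrite (card_uniqP l_uniq) l_size card_ord.
  by rewrite (subset_cardP l_card (subset_predT _)).
have lt_index i : (index i l < n)%N by rewrite -{2}l_size index_mem.
have s_inj : injective (fun i => Ordinal (lt_index i)).
  by move=> i j [] /(congr1 (nth i l)); rewrite !nth_index.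
exists (perm s_inj) => i; rewrite mxE.
under eq_bigl => j do rewrite !permE.
exact: l_burn.
Qed.

(** As long as the fire leaves a set U of vertices unburnt, firing U (adding its
    indicator function to the potential) keeps the vertices of U above -1 and
    lowers no other vertex.  The linear system is empty, so some vertex is never
    above -1 and never fires; with [lap_bound] this bounds the number of firings
    of every vertex.  Hence the process stops, and then everything burns. *)
Lemma special_le_order_div D : (forall c, exists i, (D - lap c) 0 i <= -1) ->
  exists s c, forall i, (D - lap c) 0 i <= order_div s 0 i.
Proof.
move=> D_special; pose bad c i := (D - lap c) 0 i <= -1.
(* The invariants of the process; the last one bounds D - lap c from below. *)
pose good c := [/\ forall i, 0 <= c i, forall i, bad c i -> c i = 0
  & forall i, D 0 i <= (D - lap c) 0 i \/ ~~ bad c i].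
(* D 0 i <= (D - lap c) 0 i gives lap c 0 i <= 0, and -1 < (D - lap c) 0 i
   gives lap c 0 i < D 0 i + 1. *)
have [K K_bound] := lap_bound (\sum_i `|D 0 i| + 1).
have good_le c i : good c -> c i <= K%:Z.
  case=> c_ge0 c_bad c_low; have [q /c_bad cq0] := D_special c.
  rewrite -[c i]subr0 -cq0; apply: K_bound => k.
  have : D 0 k <= \sum_i `|D 0 i|.
    by rewrite (le_trans (ler_norm _)) // (bigD1 k) //= lerDl sumr_ge0.
  have : 0 <= \sum_i `|D 0 i| by exact: sumr_ge0.
  have := c_low k; rewrite /bad !mxE -ltNge; case; lra.
suff [c [_ /burning_order[s Ds]]] : exists c, good c /\ burnt (D - lap c).
  by exists s, c.
pose burntb c := [forall U : {set 'I_n}, [exists i, i \in U] ==>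
  [exists i in U, (D - lap c) 0 i <= -1 + \sum_(j | j \notin U) w i j]].
have burntP c : burntb c -> burnt (D - lap c).
  move=> /forallP cb U /existsP /(implyP (cb U)) /existsP[i /andP[iU Di]].
  by exists i.
suff step (m : nat) : exists c, good c /\ (burntb c \/ m%:Z <= \sum_i c i).
  have [c [c_good [/burntP c_burnt|]]] := step (n * K).+1; first by exists c.
  have : \sum_i c i <= \sum_(i < n) K%:Z by apply: ler_sum => i _; apply: good_le.
  rewrite sumr_const card_ord => le1 le2; have := le_trans le2 le1.
  by rewrite -mulr_natr natz -PoszM lez_nat mulnC ltnn.
elim: m => [|m [c [c_good [c_burnt|c_sum]]]].
- exists (fun=> 0); split; last by right; rewrite big1.
  by split=> // i; left; rewrite lap0 subr0.
- by exists c; split => //; left.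
have [c_burnt|] := boolP (burntb c); first by exists c; split => //; left.
rewrite negb_forall => /existsP[U]; rewrite negb_imply => /andP[/existsP[u uU]].
move=> /existsPn U_stuck.
pose d i : int := (i \in U)%:Z.
have lap_in i : i \in U -> lap d 0 i = \sum_(j | j \notin U) w i j.
  move=> iU; rewrite mxE [RHS]big_mkcond; apply: eq_bigr => j _; rewrite /d iU.
  by case: (j \in U); rewrite ?subrr ?mulr0 ?subr0 ?mulr1.
have lap_out i : i \notin U -> lap d 0 i <= 0.
  move=> /negPf iU; rewrite mxE sumr_le0 // => j _; rewrite /d iU sub0r.
  by rewrite mulr_ge0_le0 ?weight_ge0 // intrN oppr_le0 ler0z.
have DE i : (D - lap (fun i => c i + d i)) 0 i = (D - lap c) 0 i - lap d 0 i.
  by rewrite lapD opprD addrA mxE [(- lap d) 0 i]mxE.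
case: c_good => c_ge0 c_bad c_low.
exists (fun i => c i + d i); split; last first.
  right; rewrite big_split /= -addn1 PoszD lerD // (bigD1 u) //= /d uU lerDl.
  exact: sumr_ge0.
have U_ok i : i \in U -> ~~ bad (fun i => c i + d i) i.
  move=> iU; rewrite /bad DE lap_in // -ltNge.
  have := U_stuck i; rewrite iU /= -ltNge; lra.
have nU_ok i : i \notin U -> (D - lap c) 0 i <= (D - lap (fun i => c i + d i)) 0 i.
  by move=> /lap_out; rewrite DE; lra.
split=> i; first by rewrite addr_ge0.
- have [/U_ok/negP //|iU] := boolP (i \in U).
  move=> /(le_trans (nU_ok i iU)) /c_bad ->; by rewrite /d (negPf iU).
- have [/U_ok|iU] := boolP (i \in U); first by right.
  case: (c_low i) => [le_D|]; first by left; apply: le_trans le_D (nU_ok i iU).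
  by rewrite /bad -!ltNge => /lt_le_trans/(_ (nU_ok i iU)); right.
Qed.

(** * The dimension as a minimum over orderings and potentials *)

Definition posdeg D : R := \sum_i Num.max 0 (D 0 i).

Definition excess D s c : R := posdeg (D - order_div s + lap c).

Lemma order_div_over s : order_div s \is a mxOver S.
Proof.
apply/mxOverP => i j; rewrite mxE rpredD ?rpredN1 // rpred_sum // => k _.
exact: (mxOverP (weight_over G)).
Qed.

(** Removing from D the positive part of D - N leaves a divisor that is at most
    N, where N = order_div s - lap c. *)
Lemma excess_in_h0_degrees D s c : D \is a mxOver S ->
  h0_degrees G D (excess D s c).
Proof.
move=> D_div; set A := D - order_div s + lap c.
have A_div : A \is a mxOver S.
  by rewrite rpredD ?rpredB ?lap_over ?order_div_over.
pose E : 'rV[R]_n := \row_i Num.max 0 (A 0 i).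
have E_div : E \is a mxOver S.
  apply/mxOverP => i j; rewrite mxE maxElt; case: ifP => _; rewrite ?rpred0 //.
  exact: (mxOverP A_div).
exists E; last by apply: eq_bigr => i _; rewrite mxE.
split=> // [i|]; first by rewrite mxE le_max lexx.
apply/linear_system_eq0 => [|c']; first exact: rpredB.
have [i Hi] := order_div_special s (fun i => c i + c' i).
exists i; apply: le_trans Hi.
have : A 0 i <= E 0 i by rewrite [E _ _]mxE le_max lexx orbT.
rewrite /A lapD; move: (order_div s) (lap c) (lap c') => V L L'.
by rewrite !mxE; lra.
Qed.

Lemma excess_le_h0_degrees D m : D \is a mxOver S -> h0_degrees G D m ->
  exists s c, excess D s c <= m.
Proof.
move=> D_div [E [E_div E_ge0 DE0] <-].
have /linear_system_eq0 : linear_system G (D - E) = set0 by [].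
case/(_ (rpredB D_div E_div))/special_le_order_div => s [c le_s].
exists s, (fun i => - c i); apply: ler_sum => i _.
rewrite ge_max E_ge0 /= lapN; have := le_s i.
by move: (order_div s) (lap c) => V L; rewrite !mxE; lra.
Qed.

(** A potential whose excess, for any ordering, is at most the value B0 at the
    identity ordering and the zero potential has its Laplacian bounded above by
    a constant that does not depend on the ordering.  Translated to have minimum 0, it
    takes its values in a fixed finite interval, so that a minimum over
    a finite type suffices. *)
Lemma excess_min D : exists s c, forall s' c', excess D s c <= excess D s' c'.
Proof.
pose B0 := excess D 1%g (fun=> 0).
pose B := B0 + \sum_i `|D 0 i| + \sum_s \sum_i `|order_div s 0 i|.
have [K K_bound] := lap_bound B.
pose cast (f : {ffun 'I_n -> 'I_K.+1}) i : int := (f i : nat)%:Z.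
pose val (p : {perm 'I_n} * {ffun 'I_n -> 'I_K.+1}) := excess D p.1 (cast p.2).
have [[s f] _ sf_min] := arg_minP val (isT : xpredT (1%g, [ffun=> ord0])).
exists s, (cast f) => s' c'.
have le_B0 : excess D s (cast f) <= B0.
  apply: le_trans (sf_min (1%g, [ffun=> ord0]) isT) _.
  rewrite /val /B0 /excess /= le_eqVlt; apply/orP; left; apply/eqP.
  congr (posdeg (_ + _)); apply/rowP => i; rewrite !mxE.
  by apply: eq_bigr => j _; rewrite /cast !ffunE.
have [lt_B0|le_B0'] := ltP B0 (excess D s' c'); first exact: le_trans (ltW lt_B0).
have c'_bound : forall i j, c' i - c' j <= K%:Z.
  apply: K_bound => i.
  have : (D - order_div s' + lap c') 0 i <= B0.
    apply: le_trans le_B0'; rewrite /excess; set A := _ + lap c'.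
    apply: le_trans (_ : Num.max 0 (A 0 i) <= _); first by rewrite le_max lexx orbT.
    rewrite /posdeg (bigD1 i) //= lerDl sumr_ge0 // => j _.
    by rewrite le_max lexx.
  have : - D 0 i <= \sum_i `|D 0 i|.
    by rewrite (le_trans (ler_norm _)) // normrN (bigD1 i) //= lerDl sumr_ge0.
  have : order_div s' 0 i <= \sum_s \sum_i `|order_div s 0 i|.
    rewrite (le_trans (ler_norm _)) // (bigD1 s') //= (bigD1 i) //= -addrA.
    by rewrite lerDl addr_ge0 ?sumr_ge0 // => j _; rewrite sumr_ge0.
  rewrite /B; move: (order_div s') (lap c') => V L; rewrite !mxE; lra.
pose i0 := Ordinal (wgraph_nonempty G).
have [k _ k_min] := arg_minP c' (isT : xpredT i0).
pose f' : {ffun 'I_n -> 'I_K.+1} := [ffun i => inord `|c' i - c' k|%N].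
have f'E : cast f' =1 (fun i => c' i - c' k).
  move=> i; have ge0 : 0 <= c' i - c' k by rewrite subr_ge0; exact: k_min.
  have := c'_bound i k; rewrite /cast ffunE -(gez0_abs ge0) lez_nat => ?.
  by rewrite inordK ?ltnS.
apply: le_trans (sf_min (s', f') isT) _; rewrite /val /excess /= le_eqVlt.
apply/orP; left; apply/eqP; rewrite -(lap_shift c' (c' k)).
congr (posdeg (_ + _)); apply/rowP => i; rewrite !mxE.
by apply: eq_bigr => j _; rewrite !f'E.
Qed.

Lemma is_min_excess D s c : D \is a mxOver S ->
  (forall s' c', excess D s c <= excess D s' c') ->
  is_min (h0_degrees G D) (excess D s c).
Proof.
move=> D_div sc_min; split; first exact: excess_in_h0_degrees.
move=> m /(excess_le_h0_degrees D_div)[s' [c' le_m]].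
exact: le_trans (sc_min s' c') le_m.
Qed.

Lemma h0E D m : is_min (h0_degrees G D) m -> h0 G D = m.
Proof.
move=> m_min; rewrite /h0; case: xgetP => [x _ [x_in x_lb]|/(_ m)//].
case: m_min => m_in m_lb; apply: le_anti.
by rewrite (x_lb _ m_in) (m_lb _ x_in).
Qed.

Lemma posdegN D : posdeg (- D) = posdeg D - degd D.
Proof.
rewrite /posdeg /degd -sumrB; apply: eq_bigr => i _; rewrite mxE.
by case: (lerP 0 (- D 0 i)); case: (lerP 0 (D 0 i)); lra.
Qed.

(** The divisor N = order_div s - lap c of the value for D corresponds to K - N
    for K - D, and (K - D) - (K - N) = - (D - N). *)
Lemma excess_dual D s c :
  excess (canonical_div G - D) (rev_order s) (fun i => - c i)
  = excess D s c - (degd D + 1 - genus G).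
Proof.
rewrite /excess lapN -canonical_sub_order_div.
have -> : canonical_div G - D - (canonical_div G - order_div s) - lap c =
    - (D - order_div s + lap c) by apply/rowP => i; rewrite !mxE; lra.
rewrite posdegN !degdD degdN degd_order_div degd_lap; lra.
Qed.
End RiemannRoch.

Theorem theorem1p2 (R : realType) (S : subringClosed R) (n : nat)
    (G : wgraph S n) (D : 'rV[R]_n) (D_div : D \is a mxOver S) :
  [/\ is_min (h0_degrees G D) (h0 G D),
      is_min (h0_degrees G (canonical_div G - D)) (h0 G (canonical_div G - D))
    & h0 G D - h0 G (canonical_div G - D) = degd D + 1 - genus G].
Proof.
have K_div : canonical_div G \is a mxOver S.
  rewrite -(subrK (order_div G 1%g) (canonical_div G)) canonical_sub_order_div.
  by rewrite rpredD ?order_div_over.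
have [s [c sc_min]] := excess_min G D.
have [s' [c' sc'_min]] := excess_min G (canonical_div G - D).
have D_min := is_min_excess D_div sc_min.
have KD_min := is_min_excess (rpredB K_div D_div) sc'_min.
rewrite (h0E D_min) (h0E KD_min); split=> //.
(* Duality turns each minimiser into a competitor of the other one. *)
have := sc'_min (rev_order s) (fun i => - c i); rewrite excess_dual.
have := sc_min (rev_order s') (fun i => - c' i).
have := excess_dual G (canonical_div G - D) s' c'; rewrite subKr => ->.
rewrite degdD degdN degd_canonical; lra.
Qed.
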